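(* Let $\mathcal{R}$ be a commutative ring with identity and $\frac12\in\mathcal{R}$, and let $\mathcal{G}=\mathcal{G}(A,M,N,B)$ and $\mathcal{G}'=\mathcal{G}'(A',M',N',B')$ be two generalized matrix algebras over $\mathcal{R}$. Let $\theta\colon\mathcal{G}\to\mathcal{G}'$ be a Lie triple isomorphism. Suppose that (1) each commuting linear mapping on $A'$ or $B'$ is proper; (2) $\pi_{A'}(\mathcal{Z}(\mathcal{G}'))=\mathcal{Z}(A')\neq A'$ and $\pi_{B'}(\mathcal{Z}(\mathcal{G}'))=\mathcal{Z}(B')\neq B'$; (3) either $A$ or $B$ is noncommutative; (4) $M'$ is loyal. Then $\theta=\pm\mathfrak{m}+\mathfrak{n}$, where $\mathfrak{m}\colon\mathcal{G}\to\mathcal{G}'$ is a Jordan homomorphism, $\mathfrak{m}$ is one-to-one, and $\mathfrak{n}\colon\mathcal{G}\to\mathcal{Z}(\mathcal{G}')$ is a linear mapping sending second commutators to zero (i.e. $\mathfrak{n}([[x,y],z])=0$ for all $x,y,z\in\mathcal{G}$). Moreover, if $\mathcal{G}'$ is central over $\mathcal{R}$, then $\mathfrak{m}$ is surjective.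
   Context: $\mathcal{Z}(\cdot)$ denotes the center of an algebra and $[x,y]=xy-yx$. A generalized matrix algebra $\mathcal{G}(A,M,N,B)$ over $\mathcal{R}$ arises from a Morita context: unital $\mathcal{R}$-algebras $A,B$, an $(A,B)$-bimodule $M$, a $(B,A)$-bimodule $N$, and bimodule homomorphisms $\Phi_{MN}\colon M\otimes_B N\to A$, $\Psi_{NM}\colon N\otimes_A M\to B$ (written $mn$, $nm$) satisfying $(mn)m'=m(nm')$ and $(nm)n'=n(mn')$ for all $m,m'\in M$, $n,n'\in N$. Then $\mathcal{G}$ is the $\mathcal R$-algebra of all matrices $\begin{bmatrix}a&m\\ n&b\end{bmatrix}$ ($a\in A$, $m\in M$, $n\in N$, $b\in B$) with matrix-like addition and multiplication. At least one of $M,N$ is nonzero. Standing assumption for all generalized matrix algebras considered: the bimodule in the upper right corner ($M$, resp. $M'$) is faithful as a left $A$-module (resp. $A'$-module) and as a right $B$-module (resp. $B'$-module). The projections $\pi_{A'},\pi_{B'}$ send a matrix in $\mathcal{G}'$ to its $(1,1)$ and $(2,2)$ entries. $M'$ is loyal if $aM'b=0$ (with $a\in A',b\in B'$) implies $a=0$ or $b=0$. An $\mathcal R$-linear map $f\colon\mathcal{A}\to\mathcal{A}$ on a unital $\mathcal R$-algebra is commuting if $[f(a),a]=0$ for all $a$; it is proper if $f(a)=za+\eta(a)$ for all $a$, for some $z\in\mathcal{Z}(\mathcal{A})$ and some $\mathcal R$-linear $\eta\colon\mathcal{A}\to\mathcal{Z}(\mathcal{A})$. A Lie triple isomorphism is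 an $\mathcal{R}$-linear bijection $\theta$ with $\theta([[x,y],z])=[[\theta(x),\theta(y)],\theta(z)]$ for all $x,y,z$. A Jordan homomorphism is an $\mathcal{R}$-linear map $\mathfrak m$ with $\mathfrak{m}(x\circ y)=\mathfrak{m}(x)\circ\mathfrak{m}(y)$ for all $x,y$, where $x\circ y=xy+yx$. $\mathcal{G}'$ is central over $\mathcal{R}$ if $\mathcal{Z}(\mathcal{G}')=\mathcal{R}\cdot 1$. *)

(* Defs.v *)
From HB Require Import structures.
From mathcomp Require Import all_boot all_order all_algebra.

Set Implicit Arguments.
Unset Strict Implicit.
Unset Printing Implicit Defensive.

Import GRing.Theory.
Local Open Scope ring_scope.

Reserved Notation "a <*: m" (at level 40, left associativity).
Reserved Notation "m :*> b" (at level 40, left associativity).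

(* Unital (A, B)-bimodules on which the two actions of R, through A and
   through B, both agree with the R-module structure. *)
HB.mixin Record isBimodule (R : comPzRingType) (A B : algType R) M
    of GRing.Lmodule R M := {
  lact : A -> M -> M;
  ract : M -> B -> M;
  lactDl : forall a a' m, lact (a + a') m = lact a m + lact a' m;
  lactDr : forall a m m', lact a (m + m') = lact a m + lact a m';
  lactA : forall a a' m, lact (a * a') m = lact a (lact a' m);
  lact1 : forall m, lact 1 m = m;
  lactZ : forall (r : R) a m, lact (r *: a) m = r *: lact a m;
  ractDl : forall m m' b, ract (m + m') b = ract m b + ract m' b;
  ractDr : forall m b b', ract m (b + b') = ract m b + ract m b';
  ractA : forall m b b', ract m (b * b') = ract (ract m b) b';
  ract1 : forall m, ract m 1 = m;
  ractZ : forall (r : R) m b, ract m (r *: b) = r *: ract m b;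
  lractA : forall a m b, ract (lact a m) b = lact a (ract m b)
}.

#[short(type="bimodType")]
HB.structure Definition Bimodule (R : comPzRingType) (A B : algType R) :=
  {M of GRing.Lmodule R M & isBimodule R A B M}.

Notation "a <*: m" := (lact a m) : ring_scope.
Notation "m :*> b" := (ract m b) : ring_scope.

Section BimoduleTheory.
Variables (R : comPzRingType) (A B : algType R) (M : bimodType A B).

Definition left_faithful : Prop :=
  forall a : A, (forall m : M, a <*: m = 0) -> a = 0.

Definition right_faithful : Prop :=
  forall b : B, (forall m : M, m :*> b = 0) -> b = 0.

Definition loyal : Prop :=
  forall (a : A) (b : B), (forall m : M, (a <*: m) :*> b = 0) ->
    a = 0 \/ b = 0.

Lemma lactZr (r : R) (a : A) (m : M) : a <*: (r *: m) = r *: (a <*: m).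
Proof.
by rewrite -[in LHS](lact1 m) -lactZ -lactA -scalerAr mulr1 lactZ.
Qed.

Lemma ractZl (r : R) (m : M) (b : B) : (r *: m) :*> b = r *: (m :*> b).
Proof.
by rewrite -[in LHS](ract1 m) -ractZ -ractA -scalerAl mul1r ractZ.
Qed.

End BimoduleTheory.

Arguments left_faithful {R A B} M.
Arguments right_faithful {R A B} M.
Arguments loyal {R A B} M.

(* A bimodule homomorphism out of a tensor product is given as the balanced
   biadditive map it corresponds to; [mnprod] is Phi_MN, [nmprod] is Psi_NM. *)
Record moritaContext (R : comPzRingType) (A B : algType R)
    (M : bimodType A B) (N : bimodType B A) := MoritaContext {
  mnprod : M -> N -> A;
  nmprod : N -> M -> B;
  mnprodDl : forall m m' n, mnprod (m + m') n = mnprod m n + mnprod m' n;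
  mnprodDr : forall m n n', mnprod m (n + n') = mnprod m n + mnprod m n';
  mnprod_bal : forall m (b : B) n, mnprod (m :*> b) n = mnprod m (b <*: n);
  mnprod_lact : forall (a : A) m n, mnprod (a <*: m) n = a * mnprod m n;
  mnprod_ract : forall m n (a : A), mnprod m (n :*> a) = mnprod m n * a;
  nmprodDl : forall n n' m, nmprod (n + n') m = nmprod n m + nmprod n' m;
  nmprodDr : forall n m m', nmprod n (m + m') = nmprod n m + nmprod n m';
  nmprod_bal : forall n (a : A) m, nmprod (n :*> a) m = nmprod n (a <*: m);
  nmprod_lact : forall (b : B) n m, nmprod (b <*: n) m = b * nmprod n m;
  nmprod_ract : forall n m (b : B), nmprod n (m :*> b) = nmprod n m * b;
  mnmA : forall m n (m' : M), mnprod m n <*: m' = m :*> nmprod n m';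
  nmnA : forall n m (n' : N), nmprod n m <*: n' = n :*> mnprod m n'
}.

(* The generalized matrix algebra of C; Gma a m n b is [a m; n b]. *)
Record gma (R : comPzRingType) (A B : algType R)
    (M : bimodType A B) (N : bimodType B A) (C : moritaContext M N) :=
  Gma { piA : A; piM : M; piN : N; piB : B }.

Section GmaAlgebra.
Variables (R : comPzRingType) (A B : algType R).
Variables (M : bimodType A B) (N : bimodType B A) (C : moritaContext M N).

Let G := gma C.
Implicit Types x y z : G.

Definition gma_tuple x := (piA x, piM x, piN x, piB x).
Definition tuple_gma (t : A * M * N * B) : G :=
  Gma C t.1.1.1 t.1.1.2 t.1.2 t.2.
Lemma gma_tupleK : cancel gma_tuple tuple_gma. Proof. by case. Qed.
HB.instance Definition _ := Choice.copy (gma C) (can_type gma_tupleK).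

Definition gma_zero : G := Gma C 0 0 0 0.
Definition gma_opp x : G := Gma C (- piA x) (- piM x) (- piN x) (- piB x).
Definition gma_add x y : G :=
  Gma C (piA x + piA y) (piM x + piM y) (piN x + piN y) (piB x + piB y).
Definition gma_scale (r : R) x : G :=
  Gma C (r *: piA x) (r *: piM x) (r *: piN x) (r *: piB x).
Definition gma_one : G := Gma C 1 0 0 1.
Definition gma_mul x y : G :=
  Gma C (piA x * piA y + mnprod C (piM x) (piN y))
        (piA x <*: piM y + piM x :*> piB y)
        (piN x :*> piA y + piB x <*: piN y)
        (nmprod C (piN x) (piM y) + piB x * piB y).

Fact gma_addA : associative gma_add.
Proof. by move=> x y z; rewrite /gma_add /= !addrA. Qed.
Fact gma_addC : commutative gma_add.
Proof.
by move=> x y; rewrite /gma_add; congr Gma; rewrite addrC.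
Qed.
Fact gma_add0 : left_id gma_zero gma_add.
Proof. by case=> a m n b; rewrite /gma_add /= !add0r. Qed.
Fact gma_addN : left_inverse gma_zero gma_opp gma_add.
Proof. by case=> a m n b; rewrite /gma_add /= !addNr. Qed.
HB.instance Definition _ :=
  GRing.isZmodule.Build (gma C) gma_addA gma_addC gma_add0 gma_addN.

Fact gma_scaleA r s x : gma_scale r (gma_scale s x) = gma_scale (r * s) x.
Proof. by rewrite /gma_scale /= !scalerA. Qed.
Fact gma_scale1 : left_id 1 gma_scale.
Proof. by case=> a m n b; rewrite /gma_scale /= !scale1r. Qed.
Fact gma_scaleDr : right_distributive gma_scale +%R.
Proof. by move=> r x y; congr Gma; rewrite /= scalerDr. Qed.
Fact gma_scaleDl x : {morph gma_scale^~ x : r s / r + s}.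
Proof. by move=> r s; congr Gma; rewrite /= scalerDl. Qed.
HB.instance Definition _ := GRing.Zmodule_isLmodule.Build R (gma C)
  gma_scaleA gma_scale1 gma_scaleDr gma_scaleDl.

Let lact0r (A1 B1 : algType R) (P : bimodType A1 B1) (a : A1) :
  a <*: (0 : P) = 0.
Proof. by apply: (addrI (a <*: (0 : P))); rewrite -lactDr !addr0. Qed.
Let lact0l (A1 B1 : algType R) (P : bimodType A1 B1) (p : P) :
  (0 : A1) <*: p = 0.
Proof. by apply: (addrI ((0 : A1) <*: p)); rewrite -lactDl !addr0. Qed.
Let ract0r (A1 B1 : algType R) (P : bimodType A1 B1) (p : P) :
  p :*> (0 : B1) = 0.
Proof. by apply: (addrI (p :*> (0 : B1))); rewrite -ractDr !addr0. Qed.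
Let ract0l (A1 B1 : algType R) (P : bimodType A1 B1) (b : B1) :
  (0 : P) :*> b = 0.
Proof. by apply: (addrI ((0 : P) :*> b)); rewrite -ractDl !addr0. Qed.
Let mnprod0l n : mnprod C 0 n = 0.
Proof. by apply: (addrI (mnprod C 0 n)); rewrite -mnprodDl !addr0. Qed.
Let mnprod0r m : mnprod C m 0 = 0.
Proof. by apply: (addrI (mnprod C m 0)); rewrite -mnprodDr !addr0. Qed.
Let nmprod0l m : nmprod C 0 m = 0.
Proof. by apply: (addrI (nmprod C 0 m)); rewrite -nmprodDl !addr0. Qed.
Let nmprod0r n : nmprod C n 0 = 0.
Proof. by apply: (addrI (nmprod C n 0)); rewrite -nmprodDr !addr0. Qed.

Fact gma_mulA : associative gma_mul.
Proof.
move=> x y z; rewrite /gma_mul /=; congr Gma.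
- by rewrite mulrDr mulrDl mnprodDl mnprodDr mulrA mnprod_lact mnprod_ract
             mnprod_bal addrACA.
- by rewrite lactDr ractDr lactDl ractDl !lactA !ractA lractA mnmA addrACA.
- by rewrite lactDr ractDr lactDl ractDl !lactA !ractA lractA nmnA addrACA.
by rewrite mulrDr mulrDl nmprodDl nmprodDr mulrA nmprod_lact nmprod_ract
           nmprod_bal addrACA.
Qed.
Fact gma_mul1l : left_id gma_one gma_mul.
Proof.
case=> a m n b; rewrite /gma_mul /=; congr Gma.
- by rewrite mul1r mnprod0l addr0.
- by rewrite lact1 ract0l addr0.
- by rewrite lact1 ract0l add0r.
by rewrite mul1r nmprod0l add0r.
Qed.
Fact gma_mul1r : right_id gma_one gma_mul.
Proof.
case=> a m n b; rewrite /gma_mul /=; congr Gma.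
- by rewrite mulr1 mnprod0r addr0.
- by rewrite ract1 lact0r add0r.
- by rewrite ract1 lact0r addr0.
by rewrite mulr1 nmprod0r add0r.
Qed.
Fact gma_mulDl : left_distributive gma_mul +%R.
Proof.
by move=> x y z; congr Gma;
  rewrite /= ?(mulrDl, lactDl, ractDl, mnprodDl, nmprodDl) addrACA.
Qed.
Fact gma_mulDr : right_distributive gma_mul +%R.
Proof.
by move=> x y z; congr Gma;
  rewrite /= ?(mulrDr, lactDr, ractDr, mnprodDr, nmprodDr) addrACA.
Qed.
Fact gma_oner_neq0 : gma_one != 0.
Proof. by apply/eqP => -[] /eqP; rewrite oner_eq0. Qed.
HB.instance Definition _ := GRing.Zmodule_isNzRing.Build (gma C)
  gma_mulA gma_mul1l gma_mul1r gma_mulDl gma_mulDr gma_oner_neq0.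

Let mnprodZl r m n : mnprod C (r *: m) n = r *: mnprod C m n.
Proof. by rewrite -[m in LHS]lact1 -lactZ mnprod_lact -scalerAl mul1r. Qed.
Let mnprodZr r m n : mnprod C m (r *: n) = r *: mnprod C m n.
Proof. by rewrite -[n in LHS]ract1 -ractZ mnprod_ract -scalerAr mulr1. Qed.
Let nmprodZl r n m : nmprod C (r *: n) m = r *: nmprod C n m.
Proof. by rewrite -[n in LHS]lact1 -lactZ nmprod_lact -scalerAl mul1r. Qed.
Let nmprodZr r n m : nmprod C n (r *: m) = r *: nmprod C n m.
Proof. by rewrite -[m in LHS]ract1 -ractZ nmprod_ract -scalerAr mulr1. Qed.

Fact gma_scaleAl (r : R) (x y : gma C) : r *: (x * y) = (r *: x) * y.
Proof.
by congr Gma; rewrite /= scalerDr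
  ?(=^~ scalerAl, lactZ, ractZ, lactZr, ractZl, mnprodZl, nmprodZl).
Qed.
HB.instance Definition _ :=
  GRing.Lmodule_isLalgebra.Build R (gma C) gma_scaleAl.
Fact gma_scaleAr (r : R) (x y : gma C) : r *: (x * y) = x * (r *: y).
Proof.
by congr Gma; rewrite /= scalerDr
  ?(=^~ scalerAr, lactZ, ractZ, lactZr, ractZl, mnprodZr, nmprodZr).
Qed.
HB.instance Definition _ :=
  GRing.Lalgebra_isAlgebra.Build R (gma C) gma_scaleAr.

End GmaAlgebra.

Section AlgebraNotions.
Variables (R : comPzRingType) (A : algType R).

Definition central (x : A) : Prop := forall y : A, GRing.comm x y.

Definition lie (x y : A) : A := x * y - y * x.

Definition jordan (x y : A) : A := x * y + y * x.

Definition noncommutative : Prop := ~ (forall x y : A, x * y = y * x).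

Definition central_over : Prop :=
  forall x : A, central x <-> exists r : R, x = r%:A.

Definition commuting (f : {linear A -> A}) : Prop :=
  forall a : A, lie (f a) a = 0.

Definition proper_map (f : {linear A -> A}) : Prop :=
  exists (z : A) (eta : {linear A -> A}),
    [/\ central z, forall a, central (eta a)
      & forall a, f a = z * a + eta a].

End AlgebraNotions.

Arguments noncommutative {R} A.
Arguments central_over {R} A.

Section AlgebraMaps.
Variables (R : comPzRingType) (A A' : algType R).

Definition lie_triple_iso (f : {linear A -> A'}) : Prop :=
  bijective f /\
  forall x y z : A, f (lie (lie x y) z) = lie (lie (f x) (f y)) (f z).

Definition jordan_hom (f : {linear A -> A'}) : Prop :=
  forall x y : A, f (jordan x y) = jordan (f x) (f y).

End AlgebraMaps.

(* Standing assumptions on a generalized matrix algebra; nothing is asked of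
   N beyond the disjunction. *)
Definition gma_standing (R : comPzRingType) (A B : algType R)
    (M : bimodType A B) (N : bimodType B A) : Prop :=
  [/\ (exists m : M, m != 0) \/ (exists n : N, n != 0),
      left_faithful M & right_faithful M].

(* Main.v *)
Require Import Defs.
From HB Require Import structures.
From mathcomp Require Import all_boot all_order all_algebra.
From Stdlib Require Ncring_tac ClassicalEpsilon.
Set Implicit Arguments.
Unset Strict Implicit.
Unset Printing Implicit Defensive.
Import GRing.Theory.
Local Open Scope ring_scope.

(** Write G' for the target algebra, e for its idempotent [1 0; 0 0], D for its
    diagonal matrices, u o v = uv + vu, and transport the Jordan product of
    the source along theta:

      B(u, v) = theta (theta^-1 u o theta^-1 v).

    Everything follows once B is shown to differ from u o v only by central
    data, that is

      B(u, v) = l (u o v) + mu(u) v + mu(v) u + central,     l^2 = 1,     (F)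

    with l central and mu linear with central values ([product_form]).

    Why (F) holds. Since [[x, y], z] = x o (y o z) - y o (x o z), the map theta
    carries three facts about the Jordan product over to B: the cyclic sum of
    [B(x, y), z] is central, commutators act on B as derivations, and
    B(x, B(y, z)) - B(y, B(x, z)) = [[x, y], z]. As m = [e, m] for m in M' and
    n = [n, e] for n in N', the derivation rule is available for m and n, and
    it expresses every value B(m, x) and B(n, x) through the single linear map
    B(e, _) ([bp_inM_dev], [bp_inN_dev]). On D the cyclic identity makes
    B(e, _) preserve D, act on A' and on B' by commuting maps, and have central
    cross terms; so properness of commuting maps gives, on a diagonal matrix d
    with corners a and b,

      B(e, d) = s a + t b + z(d) + z'(d) e,     s, t, z, z' central.

    The derivation rule for m applied to B(a, b) ties s to t, because loyalty
    forbids a nonzero multiple of [a, c] m [b, g] to vanish identically: this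
    leaves one coefficient l ([dev_form_signed]), and mu comes from z'. Then
    the defect in (F) is computed on each pair of Peirce components. On two
    diagonal matrices it is diagonal and commutes with M', hence central; on
    the other pairs it is explicit, and mu vanishes on [N', M'] because a map
    c from M' to the centre with c(m) m' = - c(m') m is A'-linear, and so its
    values annihilate the commutators of A'.
    Finally the triple identity on a, a', m gives l^2 [a, a'] m = [a, a'] m, so
    l^2 = 1, and the centre is a domain, so l = 1 or l = -1.

    From (F) to the theorem. Put psi = l theta + (1/2) mu theta. Then
    psi (x o y) - psi x o psi y is central; the triple identity turns this
    central gap into a relation between psi x and psi y with central
    coefficients ([gap_syzygy]), and choosing x and y with
    theta x in M' and theta y = e forces the gap to vanish. So psi is a Jordan
    homomorphism, theta = l psi - l (1/2) mu theta, and comparing psi with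
    l theta on double commutators kills the second term there. The kernel of
    psi consists of central elements and is an ideal, and no nonzero ideal of
    a faithful generalized matrix algebra is central. If the centre of G' is
    R 1, then psi 1 is a central idempotent of a domain, hence 1, so the image
    of psi contains the scalars by which psi and l theta differ. *)

(** * Noncommutative ring identities *)

#[local] Instance ncring_ops (T : pzRingType) :
  @Ncring.Ring_ops T 0 1 +%R *%R (fun x y => x - y) -%R eq := {}.
#[local] Instance ncring_ring (T : pzRingType) :
  Ncring.Ring (Ro := ncring_ops T).
Proof.
constructor; rewrite ?/Algebra_syntax.equality /=.
- by split; [move=> x|move=> x y ->|move=> x y z -> ->].
1-3: by move=> x y -> u v ->.
- by move=> x y ->.
- exact: add0r.
- exact: addrC.
- exact: addrA.
- exact: mul1r.
- exact: mulr1.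
- exact: mulrA.
- exact: mulrDl.
- by move=> x y z; exact: mulrDr.
- by [].
- exact: subrr.
Qed.

(** Decides the identities between Lie and Jordan products that hold in every
    ring. *)
Ltac ncring := rewrite ?/lie ?/jordan; Ncring_tac.non_commutative_ring.

(** * Centre, commutators and Jordan products *)

Section Center.
Variables (R : comPzRingType) (A : algType R).
Implicit Types x y z : A.

Lemma central0 : central (0 : A).
Proof. by move=> y; rewrite /GRing.comm mul0r mulr0. Qed.

Lemma central1 : central (1 : A).
Proof. by move=> y; rewrite /GRing.comm mul1r mulr1. Qed.

Lemma centralD x y : central x -> central y -> central (x + y).
Proof. by move=> xC yC z; rewrite /GRing.comm mulrDl mulrDr xC yC. Qed.

Lemma centralN x : central x -> central (- x).
Proof. by move=> xC z; rewrite /GRing.comm mulNr mulrN xC. Qed.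

Lemma centralB x y : central x -> central y -> central (x - y).
Proof. by move=> xC yC; apply: centralD => //; exact: centralN. Qed.

Lemma centralM x y : central x -> central y -> central (x * y).
Proof. by move=> xC yC z; rewrite /GRing.comm -mulrA yC !mulrA xC. Qed.

Lemma centralZ (r : R) x : central x -> central (r *: x).
Proof. by move=> xC y; rewrite /GRing.comm -scalerAl xC scalerAr. Qed.

Lemma centralP x : central x <-> forall y, lie x y = 0.
Proof.
by split=> xC y; [rewrite /lie xC subrr|apply/subr0_eq/xC].
Qed.

Lemma lie_central x y : central y -> lie x y = 0.
Proof. by move=> yC; rewrite /lie yC subrr. Qed.

Lemma lieNC x y : lie x y = - lie y x. Proof. ncring. Qed.
Lemma lieDl x y z : lie (x + y) z = lie x z + lie y z. Proof. ncring. Qed.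
Lemma lieDr x y z : lie x (y + z) = lie x y + lie x z. Proof. ncring. Qed.
Lemma lieBl x y z : lie (x - y) z = lie x z - lie y z. Proof. ncring. Qed.
Lemma lieBr x y z : lie x (y - z) = lie x y - lie x z. Proof. ncring. Qed.
Lemma lieNl x y : lie (- x) y = - lie x y. Proof. ncring. Qed.
Lemma lieNr x y : lie x (- y) = - lie x y. Proof. ncring. Qed.
Lemma liex0 x : lie x 0 = 0. Proof. ncring. Qed.
Lemma liexx x : lie x x = 0. Proof. ncring. Qed.

Lemma lieMl z x y : central z -> lie (z * x) y = z * lie x y.
Proof. by move=> zC; rewrite /lie mulrBr !mulrA (zC y). Qed.

Lemma lieMr z x y : central z -> lie x (z * y) = z * lie x y.
Proof. by move=> zC; rewrite lieNC lieMl // -mulrN -lieNC. Qed.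

Lemma jordanC x y : jordan x y = jordan y x. Proof. ncring. Qed.

Lemma jordanDl x y z : jordan (x + y) z = jordan x z + jordan y z.
Proof. ncring. Qed.
Lemma jordanDr x y z : jordan x (y + z) = jordan x y + jordan x z.
Proof. ncring. Qed.

Lemma jordanMl z x y : central z -> jordan (z * x) y = z * jordan x y.
Proof. by move=> zC; rewrite /jordan mulrDr !mulrA (zC y). Qed.

Lemma jordanMr z x y : central z -> jordan x (z * y) = z * jordan x y.
Proof. by move=> zC; rewrite jordanC jordanMl // jordanC. Qed.

Lemma jordan_central x z : central z -> jordan x z = (z + z) * x.
Proof. by move=> zC; rewrite /jordan -(zC x) -mulrDl. Qed.

Lemma lie_shiftr l p x y : central l -> central p ->
  lie x (l * y + p) = l * lie x y.
Proof. by move=> lC pC; rewrite lieDr (lie_central _ pC) addr0 lieMr. Qed.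

Lemma lie_shiftl l p x y : central l -> central p ->
  lie (l * x + p) y = l * lie x y.
Proof. by move=> lC pC; rewrite lieNC lie_shiftr // -mulrN -lieNC. Qed.

Lemma jordan_shift l p q x y : central l -> central p -> central q ->
  jordan (l * x + p) (l * y + q) =
  l * l * jordan x y + l * ((p + p) * y + (q + q) * x) + (p * q + p * q).
Proof.
move=> lC pC qC; rewrite jordanDl jordanMl // [jordan p _]jordanC.
rewrite (jordan_central _ pC) jordanDr jordanMr // (jordan_central x qC).
by rewrite !mulrDr [(p + p) * (l * y)]mulrA -(lC (p + p)); ncring.
Qed.

Lemma lie_jordan w x y :
  lie w (jordan x y) = jordan (lie w x) y + jordan x (lie w y).
Proof. ncring. Qed.

Lemma jordan_cyc x y z :
  lie (jordan x y) z + lie (jordan y z) x + lie (jordan z x) y = 0.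
Proof. ncring. Qed.

Lemma lie_lieE x y z :
  lie (lie x y) z = jordan x (jordan y z) - jordan y (jordan x z).
Proof. ncring. Qed.

End Center.

(** If k = [c, a], then [c, ac] = k c is central, so [k c, a] = k k vanishes. *)
Lemma inner_central (R : comPzRingType) (A : algType R) (c : A) :
    (forall x : A, central x -> x * x = 0 -> x = 0) ->
  (forall a, central (lie c a)) -> central c.
Proof.
move=> red cC; apply/centralP => a; apply: red => //.
have e : lie c a * c = lie c (a * c) by ncring.
have /centralP/(_ a) : central (lie c a * c) by rewrite e.
by rewrite lieMl.
Qed.

(** * Halving, and linear choice *)

Section Half.
Variables (R : comPzRingType) (V : lmodType R).
Hypothesis half : exists h : R, h * 2%:R = 1.

Lemma double_eq0 (x : V) : x + x = 0 -> x = 0.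
Proof.
case: half => h h2 /(congr1 (GRing.scale h)).
by rewrite scaler0 -mulr2n -scaler_nat scalerA h2 scale1r.
Qed.

Lemma exists_half : exists h : R, forall v : V, h *: v + h *: v = v.
Proof.
case: half => h h2; exists h => v.
by rewrite -mulr2n -scaler_nat scalerA mulrC h2 scale1r.
Qed.
End Half.

Section LinearChoice.
Variables (R : comPzRingType) (V W : lmodType R).

Lemma linear_bundle (f : V -> W) : linear f ->
  exists g : {linear V -> W}, g =1 f.
Proof.
move=> fl.
pose g := HB.pack_for {linear V -> W} f (GRing.isLinear.Build R V W _ f fl).
by exists g.
Qed.

(** A total functional relation that is stable under linear combinations is
    the graph of a linear map. *)
Lemma linear_choice (P : V -> W -> Prop) :
    (forall v, exists w, P v w) ->
    (forall v w w', P v w -> P v w' -> w = w') ->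
    (forall r v v' w w', P v w -> P v' w' -> P (r *: v + v') (r *: w + w')) ->
  exists f : {linear V -> W}, forall v, P v (f v).
Proof.
move=> Pex Puniq Plin.
pose f v := sval (ClassicalEpsilon.constructive_indefinite_description
  _ (Pex v)).
have fP v : P v (f v).
  by rewrite /f; case: ClassicalEpsilon.constructive_indefinite_description.
have [g gE] : exists g : {linear V -> W}, g =1 f.
  by apply: linear_bundle => r v v'; apply: (Puniq _ _ _ (fP _)); exact: Plin.
by exists g => v; rewrite gE.
Qed.
End LinearChoice.

(** * Peirce components of a generalized matrix algebra *)

Section BimoduleZero.
Variables (R : comPzRingType) (A B : algType R) (M : bimodType A B).
Implicit Types (a : A) (b : B) (m : M).

Lemma lact0r a : a <*: (0 : M) = 0.
Proof. by apply: (addrI (a <*: (0 : M))); rewrite -lactDr !addr0. Qed.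
Lemma lact0l m : (0 : A) <*: m = 0.
Proof. by apply: (addrI ((0 : A) <*: m)); rewrite -lactDl !addr0. Qed.
Lemma ract0r m : m :*> (0 : B) = 0.
Proof. by apply: (addrI (m :*> (0 : B))); rewrite -ractDr !addr0. Qed.
Lemma ract0l b : (0 : M) :*> b = 0.
Proof. by apply: (addrI ((0 : M) :*> b)); rewrite -ractDl !addr0. Qed.
Lemma lactNl a m : (- a) <*: m = - (a <*: m).
Proof. by apply/eqP; rewrite -addr_eq0 -lactDl addNr lact0l. Qed.
Lemma ractNr m b : m :*> (- b) = - (m :*> b).
Proof. by apply/eqP; rewrite -addr_eq0 -ractDr addNr ract0r. Qed.
End BimoduleZero.

Section Peirce.
Variables (R : comPzRingType) (A B : algType R).
Variables (M : bimodType A B) (N : bimodType B A) (C : moritaContext M N).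
Let G := gma C.
Implicit Types (x y z : G) (a : A) (b : B) (m : M) (n : N).

Lemma mnprod0l n : mnprod C 0 n = 0.
Proof. by apply: (addrI (mnprod C 0 n)); rewrite -mnprodDl !addr0. Qed.
Lemma mnprod0r m : mnprod C m 0 = 0.
Proof. by apply: (addrI (mnprod C m 0)); rewrite -mnprodDr !addr0. Qed.
Lemma nmprod0l m : nmprod C 0 m = 0.
Proof. by apply: (addrI (nmprod C 0 m)); rewrite -nmprodDl !addr0. Qed.
Lemma nmprod0r n : nmprod C n 0 = 0.
Proof. by apply: (addrI (nmprod C n 0)); rewrite -nmprodDr !addr0. Qed.

Definition diag a b : G := Gma C a 0 0 b.
Definition inM m : G := Gma C 0 m 0 0.
Definition inN n : G := Gma C 0 0 n 0.
Definition e11 : G := diag 1 0.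

Let gma0 := (lact0r, lact0l, ract0r, ract0l, mnprod0l, mnprod0r, nmprod0l,
  nmprod0r, mul0r, mulr0, addr0, add0r, oppr0).

Lemma diagD a a' b b' : diag a b + diag a' b' = diag (a + a') (b + b').
Proof. by congr Gma; rewrite /= addr0. Qed.
Lemma opp_diag a b : - diag a b = diag (- a) (- b).
Proof. by congr Gma; rewrite /= oppr0. Qed.
Lemma diagZ (r : R) a b : r *: diag a b = diag (r *: a) (r *: b).
Proof. by congr Gma; rewrite /= scaler0. Qed.
Lemma diagB a a' b b' : diag a b - diag a' b' = diag (a - a') (b - b').
Proof. by rewrite opp_diag diagD. Qed.
Lemma inMD m m' : inM m + inM m' = inM (m + m').
Proof. by congr Gma; rewrite /= addr0. Qed.
Lemma opp_inM m : - inM m = inM (- m).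
Proof. by congr Gma; rewrite /= oppr0. Qed.
Lemma inND n n' : inN n + inN n' = inN (n + n').
Proof. by congr Gma; rewrite /= addr0. Qed.
Lemma opp_inN n : - inN n = inN (- n).
Proof. by congr Gma; rewrite /= oppr0. Qed.

Lemma diagM a a' b b' : diag a b * diag a' b' = diag (a * a') (b * b').
Proof. by congr Gma; rewrite /= !gma0. Qed.
Lemma diag_inM a b m : diag a b * inM m = inM (a <*: m).
Proof. by congr Gma; rewrite /= !gma0. Qed.
Lemma inM_diag a b m : inM m * diag a b = inM (m :*> b).
Proof. by congr Gma; rewrite /= !gma0. Qed.
Lemma diag_inN a b n : diag a b * inN n = inN (b <*: n).
Proof. by congr Gma; rewrite /= !gma0. Qed.
Lemma inN_diag a b n : inN n * diag a b = inN (n :*> a).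
Proof. by congr Gma; rewrite /= !gma0. Qed.
Lemma inM_inM m m' : inM m * inM m' = 0.
Proof. by congr Gma; rewrite /= !gma0. Qed.
Lemma inN_inN n n' : inN n * inN n' = 0.
Proof. by congr Gma; rewrite /= !gma0. Qed.
Lemma inM_inN m n : inM m * inN n = diag (mnprod C m n) 0.
Proof. by congr Gma; rewrite /= !gma0. Qed.
Lemma inN_inM n m : inN n * inM m = diag 0 (nmprod C n m).
Proof. by congr Gma; rewrite /= !gma0. Qed.
Lemma diag0 : diag 0 0 = 0. Proof. by []. Qed.
Lemma inM0 : inM 0 = 0. Proof. by []. Qed.
Lemma inN0 : inN 0 = 0. Proof. by []. Qed.

Lemma peirce x :
  x = diag (piA x) (piB x) + (inM (piM x) + inN (piN x)).
Proof. by case: x => a m n b; congr Gma; rewrite /= !gma0. Qed.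

Lemma Me11 a b : diag a b * e11 = diag a 0.
Proof. by rewrite diagM mulr1 mulr0. Qed.
Lemma e11_inM m : e11 * inM m = inM m. Proof. by rewrite diag_inM lact1. Qed.
Lemma inM_e11 m : inM m * e11 = 0. Proof. by rewrite inM_diag ract0r. Qed.
Lemma e11_inN n : e11 * inN n = 0. Proof. by rewrite diag_inN lact0l. Qed.
Lemma inN_e11 n : inN n * e11 = inN n. Proof. by rewrite inN_diag ract1. Qed.

Lemma lie_diag a a' b b' :
  lie (diag a b) (diag a' b') = diag (lie a a') (lie b b').
Proof. by rewrite /lie !diagM diagB. Qed.
(** The off-diagonal components are made of commutators, so a rule about
    commutators applies to them. *)
Lemma inM_lie m : inM m = lie e11 (inM m).
Proof. by rewrite /lie e11_inM inM_e11 subr0. Qed.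
Lemma inN_lie n : inN n = lie (inN n) e11.
Proof. by rewrite /lie e11_inN inN_e11 subr0. Qed.
Lemma lie_inM m a b : lie (inM m) (diag a b) = inM (m :*> b - a <*: m).
Proof. by rewrite /lie inM_diag diag_inM opp_inM inMD. Qed.
Lemma lie_inN n a b : lie (inN n) (diag a b) = inN (n :*> a - b <*: n).
Proof. by rewrite /lie inN_diag diag_inN opp_inN inND. Qed.
Lemma lie_inNM n m :
  lie (inN n) (inM m) = diag (- mnprod C m n) (nmprod C n m).
Proof. by rewrite /lie inM_inN inN_inM diagB sub0r subr0. Qed.
Lemma lie_e11 x : lie x e11 = inN (piN x) - inM (piM x).
Proof.
rewrite {1}(peirce x) lieDl lieDl lie_diag /lie !mulr1 !mul1r !mulr0 !mul0r.
by rewrite !subrr diag0 add0r inM_e11 e11_inM e11_inN inN_e11 sub0r subr0 addrC.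
Qed.

Lemma central_diag z : central z -> z = diag (piA z) (piB z).
Proof.
move=> zC; have := zC e11; move/eqP; rewrite -subr_eq0 -/(lie z e11) lie_e11.
move/eqP; case: z {zC} => a m n b /= h.
have := congr1 (@piM _ _ _ _ _ C) h; have := congr1 (@piN _ _ _ _ _ C) h.
by rewrite /= oppr0 addr0 add0r => -> /eqP; rewrite oppr_eq0 => /eqP ->.
Qed.

Lemma central_M z m : central z -> piA z <*: m = m :*> piB z.
Proof.
move=> zC; have := zC (inM m); rewrite (central_diag zC) /GRing.comm.
by rewrite diag_inM inM_diag => /(congr1 (@piM _ _ _ _ _ C)).
Qed.

Lemma central_piA z : central z -> central (piA z).
Proof.
move=> zC a; have := zC (diag a 0); rewrite (central_diag zC) /GRing.comm.
by rewrite !diagM => /(congr1 (@piA _ _ _ _ _ C)).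
Qed.

Lemma central_piB z : central z -> central (piB z).
Proof.
move=> zC b; have := zC (diag 0 b); rewrite (central_diag zC) /GRing.comm.
by rewrite !diagM => /(congr1 (@piB _ _ _ _ _ C)).
Qed.

Lemma central_lie_e11 x : central (lie x e11) -> x = diag (piA x) (piB x).
Proof.
move/central_diag; rewrite lie_e11; case: x => a m n b /= h.
have := congr1 (@piM _ _ _ _ _ C) h; have := congr1 (@piN _ _ _ _ _ C) h.
by rewrite /= oppr0 addr0 add0r => -> /eqP; rewrite oppr_eq0 => /eqP ->.
Qed.

(** * Central elements under faithfulness and loyalty *)

Section Faithful.
Hypotheses (fA : left_faithful M) (fB : right_faithful M).

Lemma diag_inM_eq0 a b : (forall m, diag a b * inM m = 0) -> a = 0.
Proof.
move=> h; apply: fA => m.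
by have := h m; rewrite diag_inM => /(congr1 (@piM _ _ _ _ _ C)).
Qed.

Lemma central_eq0A z : central z -> piA z = 0 -> z = 0.
Proof.
move=> zC z0; rewrite (central_diag zC) z0; congr Gma.
by apply: fB => m; rewrite -central_M// z0 lact0l.
Qed.

Lemma central_eq0B z : central z -> piB z = 0 -> z = 0.
Proof.
move=> zC z0; rewrite (central_diag zC) z0; congr Gma.
by apply: fA => m; rewrite central_M// z0 ract0r.
Qed.

Lemma central_eq0M z : central z -> (forall m, z * inM m = 0) -> z = 0.
Proof.
move=> zC h; apply: central_eq0A => //.
by apply: (@diag_inM_eq0 _ (piB z)) => m; rewrite -central_diag.
Qed.

Lemma central_diagl0 a : central (diag a 0) -> a = 0.
Proof. by move=> /central_eq0B -/(_ erefl) /(congr1 (@piA _ _ _ _ _ C)). Qed.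

Lemma central_diag0r b : central (diag 0 b) -> b = 0.
Proof. by move=> /central_eq0A -/(_ erefl) /(congr1 (@piB _ _ _ _ _ C)). Qed.

Lemma central_e11_eq0 z : central z -> central (z * e11) -> z = 0.
Proof.
move=> zC; rewrite {1}(central_diag zC) Me11 => /central_diagl0.
exact: central_eq0A.
Qed.

(** The second centre is the centre: taking commutators with e and with the
    Peirce components produces elements that are off-diagonal or have a zero
    corner, and faithfulness leaves no such central element but 0. *)
Lemma central_of_lie_central w : (forall x, central (lie w x)) -> central w.
Proof.
move=> h.
have M0 m : central (inM m) -> m = 0.
  by move/central_diag/(congr1 (@piM _ _ _ _ _ C)).
have N0 n : central (inN n) -> n = 0.
  by move/central_diag/(congr1 (@piN _ _ _ _ _ C)).
have wE := central_lie_e11 (h e11).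
set a := piA w in wE; set b := piB w in wE; rewrite wE in h *.
have wM m : lie (diag a b) (inM m) = 0.
  have := h (inM m); rewrite lieNC lie_inM opp_inM => /M0 ->; exact: inM0.
have wN n : lie (diag a b) (inN n) = 0.
  have := h (inN n); rewrite lieNC lie_inN opp_inN => /N0 ->; exact: inN0.
have wA a' : lie a a' = 0.
  by apply: central_diagl0; have := h (diag a' 0); rewrite lie_diag liex0.
have wB b' : lie b b' = 0.
  by apply: central_diag0r; have := h (diag 0 b'); rewrite lie_diag liex0.
apply/centralP => x.
by rewrite (peirce x) !lieDr wM wN lie_diag wA wB diag0 !addr0.
Qed.

Lemma central_ideal_eq0 w : (forall x, central (w * x)) -> w = 0.
Proof.
by move=> h; apply: central_e11_eq0 => //; rewrite -[w]mulr1.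
Qed.

Section Loyal.
Hypothesis centA :
  forall a, (exists z : G, central z /\ piA z = a) <-> central a.
Hypothesis centB :
  forall b, (exists z : G, central z /\ piB z = b) <-> central b.
Hypothesis nA : ~ (forall a, central a).
Hypothesis nB : ~ (forall b, central b).
Hypothesis lM : loyal M.

Lemma diag_split a b : central a -> central b ->
  exists z z' : G, [/\ central z, central z' & diag a b = z + z' * e11].
Proof.
move=> /centA[z [zC za]] /centB[w [wC wb]].
exists w, (z - w); split=> //; first exact: centralB.
rewrite (central_diag zC) (central_diag wC) za wb diagB Me11 diagD addr0.
by rewrite addrCA subrr addr0.
Qed.

(** Commuting with M makes a central in A, by faithfulness; the central element
    of the whole algebra above a then has lower corner b, again by
    faithfulness. This is what spares any computation with N. *)
Lemma central_of_inM a b :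
  (forall m, lie (inM m) (diag a b) = 0) -> central (diag a b).
Proof.
move=> h.
have {}h m : a <*: m = m :*> b.
  have := h m; rewrite lie_inM => /(congr1 (@piM _ _ _ _ _ C)) /= /eqP.
  by rewrite subr_eq0 => /eqP.
have /centA[z [zC za]] : central a.
  apply/centralP => c; apply: fA => m; rewrite /lie lactDl lactNl !lactA.
  by rewrite h lractA -h subrr.
suff -> : diag a b = z by [].
rewrite (central_diag zC) za; congr Gma; apply/subr0_eq/fB => m.
by rewrite ractDr ractNr -h -za central_M// subrr.
Qed.

Lemma central_domain z z' : central z -> central z' -> z * z' = 0 ->
  z = 0 \/ z' = 0.
Proof.
move=> zC z'C; rewrite {1}(central_diag zC) {1}(central_diag z'C) diagM.
move=> /(congr1 (@piA _ _ _ _ _ C)) /= zz'.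
have [m||] := lM (a := piA z) (b := piB z').
- by rewrite -central_M// -lactA -(central_piA zC) zz' lact0l.
- by left; exact: central_eq0A.
- by right; exact: central_eq0B.
Qed.

(** The centre acts without torsion on the corner A. It may have torsion on M:
    loyalty only constrains elements that kill the whole bimodule. *)
Lemma central_torsionA z a : central z -> z * diag a 0 = 0 -> z = 0 \/ a = 0.
Proof.
move=> zC; rewrite {1}(central_diag zC) diagM.
move=> /(congr1 (@piA _ _ _ _ _ C)) /= za.
have [m||] := lM (a := a) (b := piB z); last 2 first.
- by right.
- by left; exact: central_eq0B.
by rewrite -central_M // -lactA za lact0l.
Qed.

Lemma central_reducedA a : central a -> a * a = 0 -> a = 0.
Proof.
move=> aC aa; have /centA[z [zC za]] := aC.
have za0 : z * diag a 0 = 0 by rewrite (central_diag zC) diagM za aa mulr0.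
by have [z0|//] := central_torsionA zC za0; rewrite -za z0.
Qed.

Lemma central_reducedB b : central b -> b * b = 0 -> b = 0.
Proof.
move=> bC bb; have /centB[z [zC zb]] := bC.
have zz : z * z = 0.
  apply: central_eq0B; first exact: centralM.
  by rewrite (central_diag zC) diagM /= zb.
by have [] := central_domain zC zC zz; rewrite -zb => ->.
Qed.

Lemma torsion_lieA_eq0 z : central z ->
  (forall a c, z * diag (lie a c) 0 = 0) -> z = 0.
Proof.
move=> zC h; have [//|z0] := eqVneq z 0; case: nA => a; apply/centralP => c.
by have [z0'|//] := central_torsionA zC (h a c); rewrite z0' eqxx in z0.
Qed.

Lemma loyal_lie_eq0 z : central z ->
  (forall a c m b g, z * diag (lie a c) 0 * inM m * diag 0 (lie b g) = 0) ->
  z = 0.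
Proof.
move=> zC h; apply: torsion_lieA_eq0 => // a c.
have [//|za] := eqVneq (z * diag (lie a c) 0) 0.
case: nB => b; apply/centralP => g.
have [m|zac|//] := lM (a := piA z * lie a c) (b := lie b g).
- have := h a c m b g; rewrite (central_diag zC) diagM diag_inM inM_diag.
  by move=> /(congr1 (@piM _ _ _ _ _ C)).
by move: za; rewrite {1}(central_diag zC) diagM zac mulr0 eqxx.
Qed.

(** * A second product with the same triple commutators *)

(** The product bp stands for the Jordan product of another algebra, read
    through a Lie triple isomorphism. *)
Section Product.
Hypothesis half : exists h : R, h * 2%:R = 1.
Variable bp : G -> G -> G.
Hypothesis bp_linear : forall x, linear (bp x).
Hypothesis bpC : forall x y, bp x y = bp y x.
Hypothesis bp_cyc : forall x y z,
  central (lie (bp x y) z + lie (bp y z) x + lie (bp z x) y).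
Hypothesis bp_self : forall x, central (lie (bp x x) x).
Hypothesis bp_lie : forall u v x y, lie (lie u v) (bp x y) =
  bp (lie (lie u v) x) y + bp x (lie (lie u v) y).

Lemma bpDr x y z : bp x (y + z) = bp x y + bp x z.
Proof. by have := bp_linear x 1 y z; rewrite !scale1r. Qed.
Lemma bp0r x : bp x 0 = 0.
Proof. by apply: (addrI (bp x 0)); rewrite -bpDr !addr0. Qed.
Lemma bpZr x (r : R) y : bp x (r *: y) = r *: bp x y.
Proof. by have := bp_linear x r y 0; rewrite bp0r !addr0. Qed.
Lemma bpNr x y : bp x (- y) = - bp x y.
Proof. by rewrite -scaleN1r bpZr scaleN1r. Qed.
Lemma bpDl x y z : bp (x + y) z = bp x z + bp y z.
Proof. by rewrite ![bp _ z]bpC bpDr. Qed.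
Lemma bp0l x : bp 0 x = 0. Proof. by rewrite bpC bp0r. Qed.
Lemma bpNl x y : bp (- x) y = - bp x y.
Proof. by rewrite ![bp _ y]bpC bpNr. Qed.

Lemma bp_inM m x y :
  lie (inM m) (bp x y) = bp (lie (inM m) x) y + bp x (lie (inM m) y).
Proof. by have := bp_lie e11 (inM m) x y; rewrite -inM_lie. Qed.
Lemma bp_inN n x y :
  lie (inN n) (bp x y) = bp (lie (inN n) x) y + bp x (lie (inN n) y).
Proof. by have := bp_lie (inN n) e11 x y; rewrite -inN_lie. Qed.

Lemma lie_e11_eq0 x : lie x e11 = 0 -> x = diag (piA x) (piB x).
Proof. by move=> x0; apply: central_lie_e11; rewrite x0; exact: central0. Qed.

Lemma lie_diag_e11 a b : lie (diag a b) e11 = 0.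
Proof. by rewrite lie_e11 /= inM0 inN0 subr0. Qed.

(** A commutator with e is off-diagonal, so it cannot contribute to a central
    element. *)
Lemma central_off a b x : central (diag a b + lie x e11) -> lie x e11 = 0.
Proof.
move/central_diag; rewrite lie_e11; case: x => a' m n b' /= h.
have := congr1 (@piM _ _ _ _ _ C) h; have := congr1 (@piN _ _ _ _ _ C) h.
rewrite /= oppr0 addr0 !add0r => -> /eqP; rewrite oppr_eq0 => /eqP ->.
by rewrite inM0 inN0 subr0.
Qed.

Lemma bp_e11_e11 : exists z z' : G,
  [/\ central z, central z' & bp e11 e11 = z + z' * e11].
Proof.
have eD := central_lie_e11 (bp_self e11).
suff h a b : central (lie (bp e11 e11) (diag a b)).
  rewrite eD in h *; apply: diag_split; apply/centralP => c.
    apply: central_diagl0; have := h c 0.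
    by rewrite lie_diag /lie !mulr0 !mul0r subrr.
  apply: central_diag0r; have := h 0 c.
  by rewrite lie_diag /lie !mulr0 !mul0r subrr.
have := bp_cyc e11 e11 (diag a b).
rewrite -addrA -lieDl [in X in X + _]eD lie_diag => h.
by move: (h); rewrite (central_off h) addr0 eD lie_diag.
Qed.

Lemma bp_e11_diag a b :
  bp e11 (diag a b) = diag (piA (bp e11 (diag a b))) (piB (bp e11 (diag a b))).
Proof.
have eD := central_lie_e11 (bp_self e11).
have := bp_cyc e11 e11 (diag a b).
rewrite -addrA -lieDl eD lie_diag => /central_off.
rewrite [bp (diag _ _) _]bpC lieDl => /(double_eq0 half).
exact: lie_e11_eq0.
Qed.

(** With bp e e = z + z' e, the derivation rule for m on bp e e reads
    - z' m = - 2 bp e m, and similarly for n. *)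
Lemma bp_e11_offdiag : exists k : G, [/\ central k,
  forall m, bp e11 (inM m) = k * inM m & forall n, bp e11 (inN n) = k * inN n].
Proof.
have [z [z' [zC z'C ezz']]] := bp_e11_e11.
have [h h2] := exists_half G half.
have twice (x y : G) : x + x = z' * y -> x = h *: z' * y.
  move=> xx; apply/subr0_eq/(double_eq0 half).
  by rewrite addrACA xx -opprD -mulrDl h2 subrr.
exists (h *: z'); split=> [|m|n]; first exact: centralZ.
- apply: twice; have := bp_inM m e11 e11.
  rewrite (lieNC _ e11) -inM_lie bpNl bpNr (bpC (inM m)) => h3.
  apply: oppr_inj; rewrite opprD -h3 ezz' lieDr lie_central // add0r lieMr //.
  by rewrite (lieNC _ e11) -inM_lie mulrN.
apply: twice; have := bp_inN n e11 e11; rewrite -inN_lie (bpC (inN n)) => <-.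
by rewrite ezz' lieDr lie_central // add0r lieMr // -inN_lie.
Qed.

Section Deviation.
Variable k : G.
Hypothesis kC : central k.
Hypothesis bp_eM : forall m, bp e11 (inM m) = k * inM m.
Hypothesis bp_eN : forall n, bp e11 (inN n) = k * inN n.

(** The correction k x makes this map vanish on the off-diagonal
    components. *)
Definition dev x := k * x - bp e11 x.

Lemma dev_linear : linear dev.
Proof.
move=> r x y; rewrite /dev mulrDr bpDr bpZr -scalerAr scalerBr.
by rewrite opprD addrACA.
Qed.
Lemma devD x y : dev (x + y) = dev x + dev y.
Proof. by rewrite /dev bpDr mulrDr opprD addrACA. Qed.
Lemma dev_inM m : dev (inM m) = 0.
Proof. by rewrite /dev bp_eM subrr. Qed.
Lemma dev_inN n : dev (inN n) = 0.
Proof. by rewrite /dev bp_eN subrr. Qed.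
Lemma dev_peirce x : dev x = dev (diag (piA x) (piB x)).
Proof. by rewrite {1}(peirce x) !devD dev_inM dev_inN !addr0. Qed.

Lemma bp_e11E x : bp e11 x = k * x - dev x.
Proof. by rewrite /dev opprB addrCA subrr addr0. Qed.

Lemma lie_bp_e11 x y : lie (bp e11 x) y = k * lie x y - lie (dev x) y.
Proof. by rewrite {1}bp_e11E lieBl lieMl. Qed.

(** The derivation rule for m on bp e x, solved for bp [m, e] x = - bp m x. *)
Lemma bp_inM_dev m x : bp (inM m) x = lie (inM m) (dev x) - dev (lie (inM m) x).
Proof.
have := bp_inM m e11 x; rewrite (lieNC _ e11) -inM_lie bpNl !bp_e11E.
rewrite lieBr lieMr // => h.
have -> : bp (inM m) x = (k * lie (inM m) x - dev (lie (inM m) x)) -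
   (- bp (inM m) x + (k * lie (inM m) x - dev (lie (inM m) x))).
  ncring.
by rewrite -h; ncring.
Qed.

Lemma bp_inN_dev n x : bp (inN n) x = dev (lie (inN n) x) - lie (inN n) (dev x).
Proof.
have := bp_inN n e11 x; rewrite -inN_lie !bp_e11E.
rewrite lieBr lieMr // => h.
have -> : bp (inN n) x =
   (bp (inN n) x + (k * lie (inN n) x - dev (lie (inN n) x))) -
    (k * lie (inN n) x - dev (lie (inN n) x)).
  ncring.
by rewrite -h; ncring.
Qed.

(** In the cyclic identity for e, d, d' the summand [bp d d', e] is the only
    off-diagonal one, so it vanishes. *)
Lemma bp_diag a b a' b' : exists a1 b1,
  bp (diag a b) (diag a' b') = diag a1 b1.
Proof.
have := bp_cyc e11 (diag a b) (diag a' b').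
rewrite [bp (diag a' b') e11]bpC [X in X + lie (bp e11 _) _]addrC.
rewrite -addrA addrC.
rewrite (bp_e11_diag a b) (bp_e11_diag a' b') !lie_diag diagD.
move=> /central_off/lie_e11_eq0 ->; by eexists; eexists.
Qed.

Lemma dev_diag a b :
  dev (diag a b) = diag (piA (dev (diag a b))) (piB (dev (diag a b))).
Proof.
by rewrite /dev {1}bp_e11_diag {1}(central_diag kC) diagM diagB /= !mnprod0r
  !nmprod0r addr0 add0r.
Qed.

Lemma dev_comm a b a' b' :
  central (lie (dev (diag a b)) (diag a' b') +
           lie (dev (diag a' b')) (diag a b)).
Proof.
have [a1 [b1 e]] := bp_diag a b a' b'.
have := bp_cyc e11 (diag a b) (diag a' b').
rewrite e lie_diag_e11 addr0 [bp (diag a' b') e11]bpC !lie_bp_e11.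
set u := lie (dev _) _; set v := lie (dev _) _ => h.
have -> : u + v = - (k * lie (diag a b) (diag a' b') - u
   + (k * lie (diag a' b') (diag a b) - v)) by ncring.
exact: centralN.
Qed.

Hypothesis properA : forall f : {linear A -> A}, commuting f -> proper_map f.
Hypothesis properB : forall f : {linear B -> B}, commuting f -> proper_map f.

(** [dev_comm] on opposite corners says that commutation with this entry is an
    inner derivation of A with central values. *)
Lemma dev_offA b : central (piA (dev (diag 0 b))).
Proof.
apply: inner_central => [|a]; first exact: central_reducedA.
have := dev_comm 0 b a 0; rewrite (dev_diag 0 b) (dev_diag a 0).
rewrite !lie_diag diagD => /central_piA.
by rewrite /= liex0 addr0.
Qed.

Lemma dev_offB a : central (piB (dev (diag a 0))).
Proof.
apply: inner_central => [|b]; first exact: central_reducedB.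
have := dev_comm 0 b a 0; rewrite (dev_diag 0 b) (dev_diag a 0).
rewrite !lie_diag diagD => /central_piB.
by rewrite /= liex0 add0r.
Qed.

(** [dev_comm] with twice the same a puts 2 [_, a] alone in the upper corner. *)
Lemma dev_commA a : lie (piA (dev (diag a 0))) a = 0.
Proof.
apply: (double_eq0 half); apply: central_diagl0.
have := dev_comm a 0 a 0; rewrite dev_diag !lie_diag diagD.
by rewrite liex0 addr0.
Qed.

Lemma dev_commB b : lie (piB (dev (diag 0 b))) b = 0.
Proof.
apply: (double_eq0 half); apply: central_diag0r.
have := dev_comm 0 b 0 b; rewrite dev_diag !lie_diag diagD.
by rewrite liex0 addr0.
Qed.

Lemma dev_form : exists s t : G, [/\ central s, central t &
  forall a b, exists z z' : G, [/\ central z, central z' &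
    dev (diag a b) = s * diag a 0 + t * diag 0 b + (z + z' * e11)]].
Proof.
have [f fE] : exists f : {linear A -> A}, f =1 fun a => piA (dev (diag a 0)).
  apply: linear_bundle => r a a'.
  have -> : diag (r *: a + a') 0 = r *: diag a 0 + diag a' 0.
    by rewrite diagZ diagD scaler0 addr0.
  by rewrite dev_linear.
have [g gE] : exists g : {linear B -> B}, g =1 fun b => piB (dev (diag 0 b)).
  apply: linear_bundle => r b b'.
  have -> : diag 0 (r *: b + b') = r *: diag 0 b + diag 0 b'.
    by rewrite diagZ diagD scaler0 addr0.
  by rewrite dev_linear.
have [|s0 [eta [/centA[s [sC sE]] etaC fE']]] := @properA f.
  by move=> a; rewrite fE; exact: dev_commA.
have [|t0 [xi [/centB[t [tC tE]] xiC gE']]] := @properB g.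
  by move=> b; rewrite gE; exact: dev_commB.
exists s, t; split=> // a b.
have [//||z [z' [zC z'C zz']]] := diag_split
    (a := eta a + piA (dev (diag 0 b))) (b := xi b + piB (dev (diag a 0))).
- by apply: centralD => //; exact: dev_offA.
- by apply: centralD => //; exact: dev_offB.
exists z, z'; split=> //; rewrite -zz' (central_diag sC) (central_diag tC).
have -> : diag a b = diag a 0 + diag 0 b by rewrite diagD addr0 add0r.
rewrite devD (dev_diag a 0) (dev_diag 0 b) !diagM !diagD !mulr0 sE tE.
rewrite -[piA (dev (diag a 0))]fE -[piB (dev (diag 0 b))]gE fE' gE'.
by rewrite addr0 add0r [piB _ + _]addrC !addrA.
Qed.

(** For corner elements c and b, comparing the hypothesis at m with the one at
    a m turns the commutator with x into [a, x] m = t [c, a] m b. The left-hand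
    side is compatible with right multiplication of m by g, so the right-hand
    side is, whence t [c, a] m [b, g] = 0. *)
Lemma middle_coeff_eq0 (t : G) : central t ->
  (forall a b, exists x, forall m,
    lie (inM m) x = t * (diag a 0 * inM m * diag 0 b)) -> t = 0.
Proof.
move=> tC h; apply: loyal_lie_eq0 => // a c m b g.
have [x xE] := h c b.
have key m' : lie (diag a 0) x * inM m' =
    t * diag (lie c a) 0 * inM m' * diag 0 b.
  have := xE (a <*: m'); rewrite -(diag_inM a 0) => e1.
  have -> : lie (diag a 0) x * inM m' = lie (diag a 0 * inM m') x -
    diag a 0 * lie (inM m') x by ncring.
  have -> : diag (lie c a) 0 = lie (diag c 0) (diag a 0).
    by rewrite lie_diag liex0.
  rewrite e1 xE [diag a 0 * (t * _)]mulrA -(tC (diag a 0)).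
  ncring.
have -> : diag (lie a c) 0 = - diag (lie c a) 0.
  by rewrite opp_diag oppr0 -lieNC.
have -> : diag 0 (lie b g) = lie (diag 0 b) (diag 0 g).
  by rewrite lie_diag liex0.
have e1 : lie (diag a 0) x * inM m * diag 0 g =
    t * diag (lie c a) 0 * (inM m * diag 0 g) * diag 0 b.
  by rewrite -[_ * inM m * _]mulrA inM_diag key.
rewrite key in e1.
have -> : t * - diag (lie c a) 0 * inM m * lie (diag 0 b) (diag 0 g) =
    t * diag (lie c a) 0 * (inM m * diag 0 g) * diag 0 b -
    t * diag (lie c a) 0 * inM m * diag 0 b * diag 0 g by ncring.
by rewrite e1 subrr.
Qed.

Lemma bp_inM_diag m a b :
  bp (inM m) (diag a b) = lie (inM m) (dev (diag a b)).
Proof. by rewrite bp_inM_dev lie_inM dev_inM subr0. Qed.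

Lemma bp_inN_diag n a b :
  bp (inN n) (diag a b) = - lie (inN n) (dev (diag a b)).
Proof. by rewrite bp_inN_dev lie_inN dev_inN sub0r. Qed.

Lemma lie_inM_form m z z' x : central z -> central z' ->
  lie (inM m) (x + (z + z' * e11)) = lie (inM m) x - z' * inM m.
Proof.
move=> zC z'C; rewrite 2!lieDr (lie_central _ zC) add0r lieMr // (lieNC _ e11).
by rewrite -inM_lie mulrN.
Qed.

(** For d and g in opposite corners, the derivation rule for m on bp d g shows
    that - (s + t) d m g is the commutator of m with a fixed element, so
    s + t = 0. *)
Lemma dev_form_signed : exists l : G, central l /\
  forall a b, exists z z' : G, [/\ central z, central z' &
    dev (diag a b) = l * diag (- a) b + (z + z' * e11)].
Proof.
have [s [t [sC tC stE]]] := dev_form.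
suff st : s + t = 0.
  exists t; split=> // a b; have [z [z' [zC z'C ->]]] := stE a b.
  exists z, z'; split=> //; congr (_ + _).
  have -> : s = - t by apply/eqP; rewrite -addr_eq0 st.
  by rewrite mulNr -mulrN -mulrDr opp_diag oppr0 diagD addr0 add0r.
apply/eqP; rewrite -oppr_eq0; apply/eqP; apply: middle_coeff_eq0.
  by apply: centralN; exact: centralD.
move=> a b; set d := diag a 0; set g := diag 0 b.
have [v [v' [vC v'C dE]]] := stE a 0.
have [w [w' [wC w'C gE]]] := stE 0 b.
rewrite diag0 mulr0 addr0 -/d in dE; rewrite diag0 mulr0 add0r -/g in gE.
(* The terms v', w' correct bp d g so that only the term d m g is left. *)
exists (bp d g + w' * d + v' * g) => m.
have dg : d * g = 0 by rewrite diagM mulr0 mul0r.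
have gd : g * d = 0 by rewrite diagM mulr0 mul0r.
have md : inM m * d = 0 by rewrite inM_diag ract0r.
have gm : g * inM m = 0 by rewrite diag_inM lact0l.
rewrite 2!lieDr !lieMr // bp_inM [bp d _]bpC.
have e1 : lie (inM m) d = inM (- (a <*: m)).
  by rewrite lie_inM ract0r sub0r.
have e2 : lie (inM m) g = inM (m :*> b).
  by rewrite lie_inM lact0l subr0.
rewrite {1}e1 {1}e2 !bp_inM_diag -/d -/g dE gE !lie_inM_form // -e1 -e2.
rewrite !lieMr //.
have -> : lie (lie (inM m) d) g = - (d * inM m * g).
  rewrite /lie md sub0r mulNr mulrN opprK [g * _]mulrA gd mul0r addr0.
  by [].
have -> : lie (lie (inM m) g) d = - (d * inM m * g).
  rewrite /lie gm subr0 -[_ * g * d]mulrA gd mulr0 sub0r.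
  by rewrite mulrA.
rewrite !mulNr !mulrN mulrDl.
ncring.
Qed.

(** The coefficient z' of e above is determined by x, since a central multiple
    z' e that is central vanishes; so it depends linearly on x. *)
Lemma exists_mu (l : G) :
    (forall a b, exists z z' : G, [/\ central z, central z' &
      dev (diag a b) = l * diag (- a) b + (z + z' * e11)]) ->
  exists mu : {linear G -> G}, forall x, central (mu x) /\
    central (dev x + l * diag (piA x) (- piB x) + mu x * e11).
Proof.
move=> lE.
pose P (x w : G) := central w /\
  central (dev x + l * diag (piA x) (- piB x) + w * e11).
apply: (linear_choice (P := P)).
- move=> x; have [z [z' [zC z'C xE]]] := lE (piA x) (piB x).
  exists (- z'); split; first exact: centralN.
  have -> : diag (piA x) (- piB x) = - diag (- piA x) (piB x).
    by rewrite opp_diag opprK.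
  rewrite dev_peirce xE; set d := diag _ _.
  by have -> : l * d + (z + z' * e11) + l * - d + - z' * e11 = z by ncring.
- move=> x w w' [wC h] [w'C h']; apply/subr0_eq/central_e11_eq0.
    exact: centralB.
  have := centralB h h'; set u := _ + l * _.
  by have -> : u + w * e11 - (u + w' * e11) = (w - w') * e11 by ncring.
move=> r x x' w w' [wC h] [w'C h']; split.
  by apply: centralD => //; exact: centralZ.
have := centralD (centralZ r h) h'; congr central.
have -> : diag (piA (r *: x + x')) (- piB (r *: x + x')) =
    r *: diag (piA x) (- piB x) + diag (piA x') (- piB x').
  by rewrite diagZ diagD scalerN -opprD.
rewrite dev_linear !scalerDr !mulrDr mulrDl -!scalerAr -scalerAl.
ncring.
Qed.

Section Mu.
Variables (l : G) (mu : {linear G -> G}).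
Hypothesis lC : central l.
Hypothesis muC : forall x, central (mu x).
Hypothesis muE :
  forall x, central (dev x + l * diag (piA x) (- piB x) + mu x * e11).

Lemma mu_inM m : mu (inM m) = 0.
Proof.
apply: central_e11_eq0 => //; have := muE (inM m).
by rewrite dev_inM /= oppr0 diag0 mulr0 !add0r.
Qed.

Lemma mu_inN n : mu (inN n) = 0.
Proof.
apply: central_e11_eq0 => //; have := muE (inN n).
by rewrite dev_inN /= oppr0 diag0 mulr0 !add0r.
Qed.

Lemma devE x : exists2 z, central z &
  dev x = z - l * diag (piA x) (- piB x) - mu x * e11.
Proof. by eexists; [exact: muE|ncring]. Qed.

Lemma bp_inM_jordan m a b : bp (inM m) (diag a b) =
  l * jordan (inM m) (diag a b) + mu (diag a b) * inM m.
Proof.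
rewrite bp_inM_diag; have [z zC ->] := devE (diag a b).
rewrite 2!lieBr (lie_central _ zC) !lieMr // (lieNC _ e11) -inM_lie /=.
rewrite sub0r mulrN opprK -mulrN; congr (l * _ + _).
rewrite lie_inM /jordan inM_diag diag_inM opp_inM inMD opprB ractNr opprK.
by rewrite addrC.
Qed.

Lemma bp_inN_jordan n a b : bp (inN n) (diag a b) =
  l * jordan (inN n) (diag a b) + mu (diag a b) * inN n.
Proof.
rewrite bp_inN_diag; have [z zC ->] := devE (diag a b).
rewrite 2!lieBr (lie_central _ zC) !lieMr // -inN_lie /=.
rewrite sub0r opprB opprK addrC; congr (l * _ + _).
by rewrite lie_inN /jordan inN_diag diag_inN inND lactNl opprK.
Qed.

Lemma bp_inM_inM m m' : bp (inM m) (inM m') = 0.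
Proof.
by rewrite bp_inM_dev dev_inM liex0 /lie !inM_inM subrr /dev mulr0 bp0r !subr0.
Qed.

Lemma bp_inN_inN n n' : bp (inN n) (inN n') = 0.
Proof.
by rewrite bp_inN_dev dev_inN liex0 /lie !inN_inN subrr /dev mulr0 bp0r !subr0.
Qed.

Lemma bp_inM_inN m n : bp (inM m) (inN n) = dev (lie (inN n) (inM m)).
Proof.
rewrite bp_inM_dev dev_inN liex0 sub0r (lieNC (inM m)).
by rewrite -[- lie _ _]scaleN1r /dev bpZr -scalerAr -scalerBr scaleN1r opprK.
Qed.

(** The error term when bp is compared with l (x o y) + mu(x) y + mu(y) x. *)
Definition defect x y := bp x y - l * jordan x y - mu x * y - mu y * x.

Lemma defectC x y : defect x y = defect y x.
Proof. by rewrite /defect bpC jordanC addrAC. Qed.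

Lemma defectDl x x' y : defect (x + x') y = defect x y + defect x' y.
Proof. rewrite /defect bpDl linearD; ncring. Qed.

Lemma defectDr x y y' : defect x (y + y') = defect x y + defect x y'.
Proof. by rewrite !(defectC x) defectDl. Qed.

(** Both bp d d' and its expected value change under commutation with m by the
    derivation rule, and they do so in the same way by [bp_inM_jordan]. *)
Lemma defect_diag a b a' b' : central (defect (diag a b) (diag a' b')).
Proof.
set d := diag a b; set d' := diag a' b'.
have dE : lie (defect d d') e11 = 0.
  have [a1 [b1 e1]] := bp_diag a b a' b'.
  rewrite /defect e1 !lieBl lie_diag_e11 !lieMl // !lie_diag_e11 !mulr0 !subr0.
  by rewrite /jordan !diagM diagD lie_diag_e11 mulr0 subr0.
rewrite (lie_e11_eq0 dE); apply: central_of_inM => m; rewrite -(lie_e11_eq0 dE).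
rewrite /defect !lieBr bp_inM [bp d _]bpC !lieMr //.
have e1 : lie (inM m) d = inM (m :*> b - a <*: m) by rewrite lie_inM.
have e2 : lie (inM m) d' = inM (m :*> b' - a' <*: m) by rewrite lie_inM.
rewrite {1}e1 {1}e2 !bp_inM_jordan -e1 -e2.
rewrite /d /d'; ncring.
Qed.

(** Let c m := mu [n, m]. As [m2, m1] = 0, the derivation rule for m2 on
    bp m1 n gives c m1 * m2 = - c m2 * m1. Applied twice, this makes c linear
    over A; hence a * c m is central for every a, and c m kills all
    commutators of A. *)
Lemma mu_inN_inM n m : mu (lie (inN n) (inM m)) = 0.
Proof.
pose c m := mu (lie (inN n) (inM m)).
have bpMN m1 m2 : lie (inM m2) (bp (inM m1) (inN n)) =
    l * lie (inM m2) (jordan (inM m1) (inN n)) + c m1 * inM m2.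
  rewrite bp_inM_inN -/(c m1); have [z zC ->] := devE (lie (inN n) (inM m1)).
  have -> : diag (piA (lie (inN n) (inM m1))) (- piB (lie (inN n) (inM m1))) =
      - jordan (inM m1) (inN n).
    by rewrite lie_inNM /jordan inM_inN inN_inM diagD addr0 add0r opp_diag.
  rewrite 2!lieBr (lie_central _ zC) !lieMr // (lieNC _ e11) -inM_lie.
  by rewrite sub0r lieNr !mulrN !opprK.
have anti m1 m2 : c m1 * inM m2 = - (c m2 * inM m1).
  have := bp_inM m2 (inM m1) (inN n); rewrite bpMN.
  have -> : lie (inM m2) (inM m1) = 0 by rewrite /lie !inM_inM subrr.
  have J : jordan (inM m1) (lie (inN n) (inM m2)) =
      - lie (inM m2) (jordan (inM m1) (inN n)).
    apply/eqP; rewrite -addr_eq0; apply/eqP.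
    transitivity (inN n * (inM m2 * inM m1) - inM m1 * inM m2 * inN n +
      (inM m2 * inM m1 * inN n - inN n * (inM m1 * inM m2))); first by ncring.
    by rewrite !inM_inM !mul0r !mulr0 !subr0 addr0.
  rewrite bp0l add0r (lieNC (inM m2) (inN n)) bpNr lie_inNM bp_inM_jordan.
  rewrite -lie_inNM J -/(c m2); set X := lie (inM m2) _ => h.
  have -> : c m1 * inM m2 = l * X + c m1 * inM m2 - l * X by ncring.
  rewrite h; ncring.
have cC m1 : central (c m1) by exact: muC.
have cA a m1 : piA (c (a <*: m1)) = a * piA (c m1).
  apply/subr0_eq/(@diag_inM_eq0 _ (piB (c (a <*: m1)))) => m2.
  have -> : diag (piA (c (a <*: m1)) - a * piA (c m1)) (piB (c (a <*: m1))) =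
      c (a <*: m1) - diag a 0 * c m1.
    rewrite [in RHS](central_diag (cC m1)) diagM mul0r.
    by rewrite [in RHS](central_diag (cC (a <*: m1))) diagB subr0.
  rewrite mulrBl -mulrA [c m1 * _]anti mulrN opprK mulrA.
  rewrite anti -(diag_inM a 0) mulrA (muC _ (diag a 0)) -mulrA.
  by rewrite addNr.
apply: torsion_lieA_eq0 => // a a'.
rewrite -/(c m) (central_diag (cC m)) diagM mulr0.
have cm : central (piA (c m)) by exact: central_piA.
have -> : piA (c m) * lie a a' = lie (a * piA (c m)) a'.
  by rewrite -cm lieMl.
rewrite -cA.
by have /centralP -> : central (piA (c (a <*: m))) by exact: central_piA.
Qed.

Lemma defect_inM m a b : defect (inM m) (diag a b) = 0.
Proof. rewrite /defect bp_inM_jordan mu_inM; ncring. Qed.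

Lemma defect_inN n a b : defect (inN n) (diag a b) = 0.
Proof. rewrite /defect bp_inN_jordan mu_inN; ncring. Qed.

Lemma defect_inM_inM m m' : defect (inM m) (inM m') = 0.
Proof.
rewrite /defect bp_inM_inM /jordan !mu_inM !inM_inM; ncring.
Qed.

Lemma defect_inN_inN n n' : defect (inN n) (inN n') = 0.
Proof.
rewrite /defect bp_inN_inN /jordan !mu_inN !inN_inN; ncring.
Qed.

Lemma defect_inM_inN m n : central (defect (inM m) (inN n)).
Proof.
have [z zC zE] := devE (lie (inN n) (inM m)).
suff -> : defect (inM m) (inN n) = z by [].
rewrite /defect bp_inM_inN zE mu_inM mu_inN mu_inN_inM lie_inNM /jordan.
rewrite inM_inN inN_inM diagD addr0 add0r /= -opp_diag.
ncring.
Qed.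

Lemma defect_central x y : central (defect x y).
Proof.
rewrite (peirce x) (peirce y) !defectDl !defectDr defect_inM_inM defect_inN_inN.
rewrite (defectC (diag _ _) (inM _)) (defectC (diag _ _) (inN _)).
rewrite !defect_inM !defect_inN (defectC (inN _) (inM _)) !add0r !addr0.
apply: centralD; first exact: defect_diag.
by apply: centralD; exact: defect_inM_inN.
Qed.

Lemma bp_diagl_inM a m :
  bp (diag a 0) (inM m) = (l * diag a 0 + mu (diag a 0)) * inM m.
Proof.
by rewrite bpC bp_inM_jordan mulrDl /jordan inM_diag ract0r add0r mulrA.
Qed.

(** bp acts on M by T a = l a + mu a, so the triple identity compares
    [T a, T c] = l^2 [a, c] with [a, c] as operators on M. *)
Lemma coeff_square :
  (forall x y z, bp x (bp y z) - bp y (bp x z) = lie (lie x y) z) -> l * l = 1.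
Proof.
move=> bp_triple.
have llC : central (l * l - 1).
  by apply: centralB; [exact: centralM|exact: central1].
apply/subr0_eq/torsion_lieA_eq0 => //.
move=> a c; pose T a := l * diag a 0 + mu (diag a 0).
have bpT a' a'' m : bp (diag a' 0) (T a'' * inM m) = T a' * (T a'' * inM m).
  have [p [q ->]] : exists p q, T a'' = diag p q.
    rewrite /T (central_diag lC) (central_diag (muC (diag a'' 0))) diagM diagD.
    by eexists; eexists.
  by rewrite diag_inM bp_diagl_inM.
have lieT : lie (T a) (T c) = l * l * lie (diag a 0) (diag c 0).
  rewrite lieDl (lieNC (mu _)) (lie_central _ (muC _)) subr0 lieDr.
  by rewrite (lie_central _ (muC _)) addr0 lieMl // lieMr // mulrA.
have lE : (l * l - 1) * diag (lie a c) 0 =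
    diag (piA (l * l - 1) * lie a c) 0.
  by rewrite {1}(central_diag llC) diagM mulr0.
rewrite lE (_ : piA (l * l - 1) * lie a c = 0) //.
apply: (@diag_inM_eq0 _ 0) => m; rewrite -lE.
have e1 : diag (lie a c) 0 = lie (diag a 0) (diag c 0).
  by rewrite lie_diag liex0.
have := bp_triple (diag a 0) (diag c 0) (inM m).
rewrite !bp_diagl_inM -/(T a) -/(T c) !bpT -e1 !mulrA -mulrBl -/(lie _ _) lieT.
rewrite {2}/lie inM_diag ract0r subr0 -e1 => h.
by rewrite mulrBl mul1r mulrBl h subrr.
Qed.

End Mu.
End Deviation.

Lemma product_form :
    (forall f : {linear A -> A}, commuting f -> proper_map f) ->
    (forall f : {linear B -> B}, commuting f -> proper_map f) ->
    (forall x y z, bp x (bp y z) - bp y (bp x z) = lie (lie x y) z) ->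
  exists (l : G) (mu : {linear G -> G}), [/\ central l, l * l = 1,
    forall x, central (mu x) &
    forall x y, central (bp x y - l * jordan x y - mu x * y - mu y * x)].
Proof.
move=> properA properB bp_triple.
have [k [kC kM kN]] := bp_e11_offdiag.
have [l [lC lE]] := dev_form_signed kC kM properA properB.
have [mu muP] := exists_mu kM kN lE.
have muC x := (muP x).1; have muE x := (muP x).2.
exists l, mu; split=> //.
  exact: coeff_square muE bp_triple.
exact: defect_central muE.
Qed.

End Product.
End Loyal.
End Faithful.
End Peirce.

(** * Transporting the Jordan product along a Lie triple isomorphism *)

Section Transport.
Variables (R : comPzRingType) (G S : algType R).
Variables (theta : {linear G -> S}) (g : S -> G).
Hypothesis thetaK : cancel theta g.
Hypothesis gK : cancel g theta.
Hypothesis theta_lie :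
  forall x y z,
    theta (lie (lie x y) z) = lie (lie (theta x) (theta y)) (theta z).

Lemma inv_linear : linear g.
Proof.
by move=> r x y; apply: (can_inj thetaK); rewrite linearP !gK.
Qed.

Lemma inv_lie x y z : g (lie (lie x y) z) = lie (lie (g x) (g y)) (g z).
Proof. by apply: (can_inj thetaK); rewrite theta_lie !gK. Qed.

Definition transport x y := theta (jordan (g x) (g y)).

Lemma transport_linear x : linear (transport x).
Proof.
move=> r y z; rewrite /transport inv_linear -linearP; congr (theta _).
by rewrite /jordan mulrDr mulrDl -scalerAr -scalerAl scalerDr addrACA.
Qed.

Lemma transportC x y : transport x y = transport y x.
Proof. by rewrite /transport jordanC. Qed.

Lemma transport_lie u v x y : lie (lie u v) (transport x y) =
  transport (lie (lie u v) x) y + transport x (lie (lie u v) y).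
Proof.
rewrite /transport !inv_lie -linearD -lie_jordan theta_lie !gK.
by [].
Qed.

Lemma transport_cyc x y z : central (lie (transport x y) z +
  lie (transport y z) x + lie (transport z x) y).
Proof.
apply/centralP => t; rewrite -[x]gK -[y]gK -[z]gK -[t]gK /transport !thetaK.
rewrite 2!lieDl -!theta_lie -!linearD -2!lieDl jordan_cyc.
by rewrite (_ : lie 0 _ = 0) ?linear0 // lieNC liex0 oppr0.
Qed.

Lemma transport_self x : central (lie (transport x x) x).
Proof.
apply/centralP => t; rewrite -[x]gK -[t]gK /transport !thetaK -theta_lie.
by rewrite (_ : lie (lie _ _) _ = 0) ?linear0 //; ncring.
Qed.

Lemma transport_triple x y z :
  transport x (transport y z) - transport y (transport x z) = lie (lie x y) z.
Proof.
by rewrite /transport !thetaK -linearB -lie_lieE theta_lie !gK.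
Qed.

End Transport.

(** * From a Jordan homomorphism modulo the centre to the theorem *)

Section AlmostJordan.
Variables (R : comPzRingType) (G S : algType R) (psi : {linear G -> S}).
Hypothesis psiJ : forall x y,
  central (psi (jordan x y) - jordan (psi x) (psi y)).
Hypothesis psiL : forall x y z,
  central (psi (lie (lie x y) z) - lie (lie (psi x) (psi y)) (psi z)).

Let gap x y := psi (jordan x y) - jordan (psi x) (psi y).
Let psiE x y : psi (jordan x y) = jordan (psi x) (psi y) + gap x y.
Proof. by rewrite /gap addrCA subrr addr0. Qed.

(** Expand [[x, y], z] = x o (y o z) - y o (x o z) under psi: each inner gap is
    central, so it multiplies psi x or psi y, and the outer gaps are central. *)
Lemma gap_syzygy x y z : central
  ((gap y z + gap y z) * psi x - (gap x z + gap x z) * psi y).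
Proof.
have gapC u v : central (gap u v) := psiJ u v.
have psi2 u v w : psi (jordan u (jordan v w)) =
    jordan (psi u) (jordan (psi v) (psi w)) + (gap v w + gap v w) * psi u +
    gap u (jordan v w).
  by rewrite 2!psiE jordanDr (jordan_central _ (gapC _ _)).
have := psiL x y z; rewrite !lie_lieE linearB !psi2.
set u := jordan _ _; set v := jordan (psi y) (jordan _ _).
set p := (gap y z + _) * _; set q := (gap x z + _) * _.
move=> h.
have -> : p - q = (u + p + gap x (jordan y z) -
    (v + q + gap y (jordan x z)) - (u - v)) -
    (gap x (jordan y z) - gap y (jordan x z)) by ncring.
by apply: centralB => //; apply: centralB; exact: gapC.
Qed.
End AlmostJordan.

Theorem theorem4p4 (R : comPzRingType)
  (A B : algType R) (M : bimodType A B) (N : bimodType B A)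
  (C : moritaContext M N)
  (A' B' : algType R) (M' : bimodType A' B') (N' : bimodType B' A')
  (C' : moritaContext M' N')
  (half : exists h : R, h * 2%:R = 1)
  (stdG : gma_standing M N) (stdG' : gma_standing M' N')
  (theta : {linear gma C -> gma C'})
  (theta_iso : lie_triple_iso theta)
  (properA' : forall f : {linear A' -> A'}, commuting f -> proper_map f)
  (properB' : forall f : {linear B' -> B'}, commuting f -> proper_map f)
  (piA'_center : forall a : A',
     (exists z : gma C', central z /\ piA z = a) <-> central a)
  (centerA' : ~ (forall a : A', central a))
  (piB'_center : forall b : B',
     (exists z : gma C', central z /\ piB z = b) <-> central b)
  (centerB' : ~ (forall b : B', central b))
  (noncommAB : noncommutative A \/ noncommutative B)
  (loyalM' : loyal M') :
  exists m n : {linear gma C -> gma C'},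
    [/\ (forall x, theta x = m x + n x) \/ (forall x, theta x = - m x + n x),
        jordan_hom m /\ injective m,
        (forall x, central (n x)) /\
        (forall x y z, n (lie (lie x y) z) = 0)
      & central_over (gma C') -> forall y, exists x, m x = y].
Proof.
have [_ fA fB] := stdG; have [_ fA' fB'] := stdG'.
have [[g thetaK gK] theta_lie] := theta_iso.
have [l [mu [lC ll muC form]]] := product_form fA' fB' piA'_center piB'_center
  centerA' centerB' loyalM' half (transport_linear thetaK gK)
  (transportC theta g) (transport_cyc thetaK gK theta_lie)
  (transport_self thetaK gK theta_lie) (transport_lie thetaK gK theta_lie)
  properA' properB' (transport_triple thetaK gK theta_lie).
have [h h2] := exists_half (gma C') half.
pose H x := h *: mu (theta x).
have HC x : central (H x) by exact: centralZ.
have HH x : H x + H x = mu (theta x) by exact: h2.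
have Hlin : linear H.
  by move=> r x y; rewrite /H linearP linearP scalerDr !scalerA mulrC.
have [psi psiE] : exists psi : {linear gma C -> gma C'},
    psi =1 fun x => l * theta x + H x.
  apply: linear_bundle => r x y; rewrite Hlin linearP mulrDr -scalerAr.
  by rewrite scalerDr addrACA.
have [n nE] : exists n : {linear gma C -> gma C'}, n =1 fun x => - (l * H x).
  apply: linear_bundle => r x y; rewrite Hlin mulrDr -scalerAr opprD.
  by rewrite -scalerN.
have psiJ x y : central (psi (jordan x y) - jordan (psi x) (psi y)).
  have := form (theta x) (theta y); rewrite /transport !thetaK => c.
  rewrite !psiE jordan_shift // !HH; set p := H x * H y + _.
  have -> : l * theta (jordan x y) + H (jordan x y) - (l * l *
      jordan (theta x) (theta y) + l * (mu (theta x) * theta y + mu (theta y) *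
      theta x) + p) = l * (theta (jordan x y) - l * jordan (theta x) (theta y) -
      mu (theta x) * theta y - mu (theta y) * theta x) + H (jordan x y) - p.
    ncring.
  apply: centralB; last by apply: centralD; exact: centralM.
  by apply: centralD; [exact: centralM|exact: HC].
have psiLE x y z : psi (lie (lie x y) z) =
    lie (lie (psi x) (psi y)) (psi z) + H (lie (lie x y) z).
  rewrite !psiE theta_lie lie_shiftr // [lie (l * theta x + _) _]lie_shiftl //.
  by rewrite lie_shiftr // mulrA ll mul1r.
have psiL x y z :
    central (psi (lie (lie x y) z) - lie (lie (psi x) (psi y)) (psi z)).
  by rewrite psiLE addrAC subrr add0r.
have gap := gap_syzygy psiJ psiL.
have psi_hom : jordan_hom psi.
  pose E x y := psi (jordan x y) - jordan (psi x) (psi y).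
  have EC x y : central (E x y + E x y) by apply: centralD; exact: psiJ.
  have gapE x y z : central ((E y z + E y z) * psi x - (E x z + E x z) * psi y).
    exact: gap.
  have psi_g u : psi (g u) = l * u + H (g u) by rewrite psiE gK.
  have lK z : central z -> (forall m, z * (l * inM C' m) = 0) -> z = 0.
    move=> zC zm; suff zl : z * l = 0 by rewrite -[z]mulr1 -ll mulrA zl mul0r.
    by apply: (central_eq0M fA' fB') => [|m]; [exact: centralM|
      rewrite -mulrA].
  (* For psi x in M' up to the centre, commuting the relation with e isolates
     the gap of e; once this is 0, commuting with m isolates any other gap. *)
  have E1 z : E (g (e11 C')) z + E (g (e11 C')) z = 0.
    apply: (lK _ (EC _ _)) => m.
    have /centralP/(_ (e11 C')) := gapE (g (inM C' m)) (g (e11 C')) z.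
    rewrite lieBl !(lieMl _ _ (EC _ _)) !psi_g !lie_shiftl //.
    rewrite liexx !mulr0 subr0.
    by rewrite lieNC -inM_lie !mulrN => /eqP; rewrite oppr_eq0 => /eqP.
  move=> x z; apply/subr0_eq/(double_eq0 half); apply: (lK _ (EC _ _)) => m.
  have /centralP/(_ (inM C' m)) := gapE x (g (e11 C')) z.
  rewrite E1 mul0r sub0r lieNl (lieMl _ _ (EC _ _)) psi_g lie_shiftl //.
  rewrite -inM_lie.
  by move/eqP; rewrite oppr_eq0 => /eqP.
have H_lie x y z : H (lie (lie x y) z) = 0.
  have := psiLE x y z; rewrite !lie_lieE linearB !psi_hom => e.
  apply: (addrI (lie (lie (psi x) (psi y)) (psi z))).
  by rewrite addr0 lie_lieE -e.
have psi_inj : injective psi.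
  (* The kernel is central, and it is an ideal, as psi (2 w x) = 0. *)
  have ker_central w : psi w = 0 -> central w.
    rewrite psiE => /eqP; rewrite addr_eq0 => /eqP lw.
    have thwC : central (theta w).
      by rewrite -[theta w]mul1r -ll -mulrA lw mulrN; apply/centralN/centralM.
    apply: (central_of_lie_central fA fB) => x; apply/centralP => y.
    apply: (can_inj thetaK); rewrite theta_lie linear0.
    rewrite [lie (theta w) _]lieNC (lie_central _ thwC) oppr0.
    by rewrite lieNC liex0 oppr0.
  move=> x y xy; apply/subr0_eq/(central_ideal_eq0 fA fB) => z.
  have w0 : psi (x - y) = 0 by rewrite linearB xy subrr.
  have wC := ker_central _ w0.
  apply: ker_central; apply: (double_eq0 half); rewrite -linearD -mulrDl.
  have := psi_hom z (x - y); rewrite jordan_central // => ->.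
  by rewrite w0 /jordan mul0r mulr0 addr0.
have l_sign : l = 1 \/ l = - 1.
  have [|||l0|l0] :=
    central_domain fA' fB' loyalM' (z := l - 1) (z' := l + 1).
  - by apply: centralB => //; exact: central1.
  - by apply: centralD => //; exact: central1.
  - have -> : (l - 1) * (l + 1) = l * l - 1 by ncring.
    by rewrite ll subrr.
  - by left; exact: subr0_eq.
  - by right; apply/eqP; rewrite -addr_eq0 l0.
exists psi, n; split=> //.
- case: l_sign => lE; [left|right] => x; rewrite psiE nE lE; ncring.
- split=> [x|x y z]; rewrite nE; first by apply: centralN; exact: centralM.
  by rewrite H_lie mulr0 oppr0.
move=> cent y.
(* theta 1 is in the second centre, which is the centre. *)
have psi1C : central (psi 1).
  rewrite psiE; apply: centralD => //; apply: centralM => //.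
  apply: (central_of_lie_central fA' fB') => u; apply/centralP => v.
  rewrite -[u]gK -[v]gK -theta_lie [lie 1 _]lieNC.
  rewrite (lie_central _ (@central1 _ _)).
  by rewrite oppr0 lieNC liex0 oppr0 linear0.
have psi1 : psi 1 = 1.
  have [||p0|p0] :=
    central_domain fA' fB' loyalM' (z := psi 1) (z' := psi 1 - 1) psi1C.
  - by apply: centralB => //; exact: central1.
  - apply: (double_eq0 half); rewrite mulrBr mulr1 addrACA -opprD.
    have -> : psi 1 + psi 1 = psi (jordan 1 1).
      by rewrite /jordan mulr1 linearD.
    by rewrite psi_hom subrr.
  - have /psi_inj/eqP : psi 1 = psi 0 by rewrite p0 linear0.
    by rewrite oner_eq0.
  - exact: subr0_eq.
(* psi (g (l * y)) is y plus a scalar, and scalars are in the image. *)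
have /cent[r rE] := HC (g (l * y)).
exists (g (l * y) - r *: 1).
by rewrite linearB linearZ /= psi1 -rE psiE gK mulrA ll mul1r addrK.
Qed.
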